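(* Let $\chi:\mathbb{R}\to\mathbb{R}$ be a strictly positive kernel satisfying conditions $(\chi1)$ and $(\chi3)$–$(\chi5)$ (listed in the context). Let $f:[0,1]\to\mathbb{R}^{+}$ be a bounded function with a strictly positive lower bound. Suppose, moreover, that there exist $a,b\in[0,1]$, with $0<a<b<1$, and $\alpha\in\mathbb{R}^{+}$ such that $f(x)=\alpha$ for every $x\in[a,b]$. Then, for any $c,d\in[a,b]$ with $a<c<d<b$, there exists $\overline{n}\in\mathbb{N}$, depending only on $a,b,c,d,f$ and $\chi$, such that $S_{n}^{\chi}(f)(x)=\alpha$ for all $x\in[c,d]$ and all $n\ge\overline{n}$.
   Context: $\mathbb{R}^{+}$ denotes the strictly positive reals. The symbol $\bigvee_{k\in J}A_k$ denotes $\sup\{A_k: k\in J\}$ (a maximum when $J$ is finite). Kernel conditions: $\chi:\mathbb{R}\to\mathbb{R}$ is bounded and measurable, strictly positive means $\chi(x)>0$ for all $x\in\mathbb{R}$, and $(\chi1)$ for some $\beta>0$, $\sup_{y\in\mathbb{R}}|\chi(y)|\,|y|^{\beta}<+\infty$; $(\chi3)$ $\chi$ is continuous on $\mathbb{R}$, $\chi(x)\ge 0$ for every $x\in\mathbb{R}$, and $\lim_{|x|\to+\infty}\chi(x)=0$; $(\chi4)$ $\chi$ is even; $(\chi5)$ $\chi(x)$ is non-decreasing for $x<0$ and non-increasing for $x\ge 0$. For bounded $f:[0,1]\to\mathbb{R}$ and $n\in\mathbb{N}$, $n\ge1$, the (truncated) max-product generalized sampling operator is $$S_{n}^{\chi}(f)(x)=\frac{\bigvee_{k=0}^{n}f\left(\frac{k}{n}\right)\chi(nx-k)}{\bigvee_{k=0}^{n}\chi(nx-k)},\quad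 x\in[0,1].$$ *)

(* Defs.v *)
From HB Require Import structures.
From mathcomp Require Import all_boot all_order all_algebra.
From mathcomp Require Import all_classical all_reals all_analysis.

Set Implicit Arguments.
Unset Strict Implicit.
Unset Printing Implicit Defensive.

Import Order.TTheory GRing.Theory Num.Theory.
Import numFieldNormedType.Exports.

Local Open Scope classical_set_scope.
Local Open Scope ring_scope.

Definition bounded_measurable (R : realType) (chi : R -> R) : Prop :=
  [bounded chi y | y in [set: R]] /\ measurable_fun [set: R] chi.

Definition strictly_positive (R : realType) (chi : R -> R) : Prop :=
  forall x : R, 0 < chi x.

(* The supremum is taken in the extended reals: the real-valued [sup] of an
   unbounded set is 0, which would make the condition vacuous. *)
Definition chi1 (R : realType) (chi : R -> R) : Prop :=
  exists2 beta : R, 0 < beta &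
    (ereal_sup [set (`|chi y| * `|y| `^ beta)%:E | y in [set: R]] < +oo)%E.

Definition chi3 (R : realType) (chi : R -> R) : Prop :=
  [/\ continuous chi,
      (forall x : R, 0 <= chi x),
      chi x @[x --> +oo] --> (0 : R)
    & chi x @[x --> -oo] --> (0 : R)].

Definition chi4 (R : realType) (chi : R -> R) : Prop :=
  forall x : R, chi (- x) = chi x.

Definition chi5 (R : realType) (chi : R -> R) : Prop :=
  (forall x y : R, x <= y -> y < 0 -> chi x <= chi y) /\
  (forall x y : R, 0 <= x -> x <= y -> chi y <= chi x).

(* Functions on [0, 1] are represented by functions on R: for 0 < n only the
   values of [f] at the points k / n of [0, 1] are used. The real [sup] of a
   nonempty finite set is its maximum, whatever the signs. *)
Definition max_product_sampling (R : realType) (chi : R -> R) (n : nat)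
    (f : R -> R) (x : R) : R :=
  sup [set f (k%:R / n%:R) * chi (n%:R * x - k%:R) | k in [set k | (k <= n)%N]]
  / sup [set chi (n%:R * x - k%:R) | k in [set k | (k <= n)%N]].

(* Main.v *)
Require Import Defs.
From HB Require Import structures.
From mathcomp Require Import all_boot all_order all_algebra.
From mathcomp Require Import all_classical all_reals all_analysis.
From mathcomp Require Import lra.

Set Implicit Arguments.
Unset Strict Implicit.
Unset Printing Implicit Defensive.

Import Order.TTheory GRing.Theory Num.Theory.
Import numFieldNormedType.Exports.

Local Open Scope classical_set_scope.
Local Open Scope ring_scope.

(** The numerator and the denominator of the operator are suprema over the same
    nodes [k / n], and on the nodes in [a, b] the samples of [f] all equal
    [alpha]. So the quotient is exactly [alpha] as soon as the nodes outside
    [a, b] influence neither supremum, which is the purely order-theoretic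
    lemma [sup_mul_div_sup]: it is enough that each of them be dominated, both
    with and without its sample, by a single node [k0 / n] in [a, b].

    Such a node is given, for large [n], by [k0 = floor (n x)]: its weight [chi (n x - k0)] is
    at least [chi 1] by monotonicity, a bound free of [n] and [x]. A node
    outside [a, b] is at distance more than [delta = min (c - a) (b - d)] from
    every [x] in [c, d], so its weight is a value of [chi] at distance more than
    [n delta] from the origin; since [chi] vanishes at infinity, this weight is
    eventually smaller than [alpha * chi 1 / M], where [M >= alpha] bounds [f].
    Multiplied by a sample it is then at most [alpha * chi 1], and alone it is
    at most [chi 1]. *)

(** Both suprema are computed on the indices where [g] equals [alpha], because
    [i0] beats every other index in the two families at once. This is what makes
    the quotient equal to [alpha] rather than merely close to it. *)
Lemma sup_mul_div_sup (R : realType) (I : Type) (A : set I) (g w : I -> R)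
    (alpha : R) (i0 : I) :
  0 < alpha -> A i0 -> g i0 = alpha -> 0 < w i0 ->
  has_ubound [set w i | i in A] ->
  (forall i, A i ->
    g i = alpha \/ w i <= w i0 /\ g i * w i <= alpha * w i0) ->
  sup [set g i * w i | i in A] / sup [set w i | i in A] = alpha.
Proof.
move=> alpha0 Ai0 gi0 wi0 ubw dom.
set D := sup [set w i | i in A]; set N := sup _.
have wD i : A i -> w i <= D by move=> Ai; apply: ub_le_sup => //; exists i.
have D0 : 0 < D := lt_le_trans wi0 (wD _ Ai0).
have gwD i : A i -> g i * w i <= alpha * D.
  move=> Ai; have [->|[_ le0]] := dom _ Ai; first by rewrite ler_pM2l// wD.
  by rewrite (le_trans le0)// ler_pM2l// wD.
have gwN i : A i -> g i * w i <= N.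
  move=> Ai; apply: ub_le_sup; last by exists i.
  by exists (alpha * D) => _ [j Aj <-]; exact: gwD.
suff -> : N = alpha * D by rewrite mulfK// gt_eqF.
apply/eqP; rewrite eq_le; apply/andP; split.
  apply: ge_sup; first by exists (g i0 * w i0), i0.
  by move=> _ [i Ai <-]; exact: gwD.
rewrite mulrC -ler_pdivlMr//; apply: ge_sup; first by exists (w i0), i0.
move=> _ [i Ai <-]; rewrite ler_pdivlMr// mulrC.
have [gi|[lei0 _]] := dom _ Ai; first by rewrite -{1}gi gwN.
by apply: (le_trans _ (gwN _ Ai0)); rewrite gi0 ler_pM2l.
Qed.

Lemma chi_norm (R : realType) (chi : R -> R) (x : R) :
  chi4 chi -> chi `|x| = chi x.
Proof. by move=> h4; case: (ger0P x) => // _; rewrite h4. Qed.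

Lemma le_chi_norm (R : realType) (chi : R -> R) (x y : R) :
  chi4 chi -> chi5 chi -> `|x| <= `|y| -> chi y <= chi x.
Proof.
by move=> h4 [_ h5] xy; rewrite -(chi_norm x h4) -(chi_norm y h4) h5.
Qed.

Theorem corollary5p1 (R : realType) (chi : R -> R)
    (hchi : bounded_measurable chi) (hpos : strictly_positive chi)
    (h1 : chi1 chi) (h3 : chi3 chi) (h4 : chi4 chi) (h5 : chi5 chi)
    (f : R -> R)
    (f_gt0 : forall x : R, x \in `[0, 1] -> 0 < f x)
    (f_bounded : [bounded f x | x in `[0, 1]])
    (f_lower : exists2 m : R, 0 < m & forall x : R, x \in `[0, 1] -> m <= f x)
    (a b alpha : R)
    (ha : 0 < a) (hab : a < b) (hb : b < 1) (halpha : 0 < alpha)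
    (f_const : forall x : R, x \in `[a, b] -> f x = alpha)
    (c d : R) (hac : a < c) (hcd : c < d) (hdb : d < b) :
  exists2 nbar : nat, (1 <= nbar)%N &
    forall (n : nat) (x : R), (nbar <= n)%N -> x \in `[c, d] ->
      max_product_sampling chi n f x = alpha.
Proof.
have [_ _ chi_pinfty _] := h3.
have [M [Malpha fM]] : exists M : R,
    alpha <= M /\ forall x, x \in `[0, 1] -> f x <= M.
  have [B [_ hB]] := f_bounded.
  exists (Num.max alpha (B + 1)); split; first by rewrite le_max lexx.
  move=> x x01; rewrite le_max; apply/orP; right.
  by rewrite (le_trans (ler_norm _))// hB// ltrDl.
have M0 : 0 < M := lt_le_trans halpha Malpha.
(* The largest weight that an outside node may have: it is dominated in the
   numerator since samples are at most [M], and in the denominator since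
   [alpha <= M]. *)
pose eps := alpha * chi 1 / M.
have eps0 : 0 < eps by rewrite divr_gt0// mulr_gt0.
have eps_chi1 : eps <= chi 1 by rewrite ler_pdivrMr// mulrC ler_pM2l.
have [A [_ chiA]] : \forall y \near +oo, chi y < eps.
  exact: (cvgr_lt _ chi_pinfty).
pose delta := Num.min (c - a) (b - d).
have delta0 : 0 < delta by rewrite lt_min !subr_gt0 hac.
have delta_ca : delta <= c - a by rewrite ge_min lexx.
have delta_bd : delta <= b - d by rewrite ge_min lexx orbT.
(* With this choice [n * delta] exceeds both [A], where the tail of [chi] falls
   below [eps], and [1], so that [floor (n x) / n] lies in [a, b]. *)
exists (Num.truncn (Num.max A 1 / delta)).+1 => // n x nbarn.
rewrite in_itv /= => /andP[cx xd].
have : Num.max A 1 < n%:R * delta.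
  rewrite -ltr_pdivrMr//; apply: lt_le_trans (truncnS_gt _) _.
  by rewrite ler_nat.
rewrite gt_max => /andP[And nd1].
have n0 : 0 < n%:R :> R by rewrite ltr0n (leq_trans _ nbarn).
have nx0 : 0 <= n%:R * x by rewrite mulr_ge0// ?ltW//; lra.
pose k0 := Num.truncn (n%:R * x).
have /andP[k0x xk0] := truncn_itv nx0; rewrite -/k0 in k0x xk0.
rewrite -natr1 in xk0.
have k0n : (k0 <= n)%N by rewrite -(ler_nat R); nra.
have chi_k0 : chi 1 <= chi (n%:R * x - k0%:R).
  by apply: le_chi_norm => //; rewrite normr1 ger0_norm; lra.
apply: (@sup_mul_div_sup _ _ _ (fun k => f (k%:R / n%:R)) _ _ k0) => //.
- by apply: f_const; rewrite in_itv /= ler_pdivlMr// ler_pdivrMr//; nra.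
- exists (chi 0) => _ [k _ <-].
  by apply: le_chi_norm => //; rewrite normr0.
move=> k /= kn; have [kab|] := boolP (k%:R / n%:R \in `[a, b]).
  by left; exact: f_const.
rewrite in_itv /= ler_pdivlMr// ler_pdivrMr// negb_and -!ltNge => kout; right.
have chi_k : chi (n%:R * x - k%:R) < eps.
  rewrite -(chi_norm _ h4); apply: chiA; apply: (lt_le_trans And).
  by rewrite ler_normr; apply/orP; case/orP: kout => kab; [left|right]; nra.
split; first by rewrite (le_trans (ltW chi_k))// (le_trans eps_chi1).
have fk : f (k%:R / n%:R) <= M.
  by apply: fM; rewrite in_itv /= divr_ge0// ler_pdivrMr// mul1r ler_nat.
apply: (@le_trans _ _ (M * eps)).
  apply: (@le_trans _ _ (M * chi (n%:R * x - k%:R))).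
    by rewrite ler_pM2r.
  by rewrite ler_pM2l// ltW.
by rewrite /eps mulrC divfK ?gt_eqF// ler_pM2l.
Qed.
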